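(* Let $S(t)=\sum_{i=0}^\infty s_it^i$ be a complex formal power series and let $a$ be a nonzero complex number. A formal power series $Q(t)=\sum_{i=0}^\infty q_it^i\in\mathbb C[[t]]$ with $Q(0)=1/a$ satisfies $$(tQ''(t)+Q'(t))Q(t)-t(Q'(t))^2=S(t)Q(t)$$ if and only if $q_i=f_S^i(a)$ for all $i\ge1$.
   Context: For $S(t)=\sum_{i\ge0}s_it^i\in\mathbb C[[t]]$, the polynomials $f_S^i(t)\in\mathbb C[t]$, $i\ge1$, are defined recursively by $f_S^1(t)=s_0$ and, for $k\ge1$, $$f_S^{k+1}(t)=\frac{s_k}{(k+1)^2}+\frac{t}{(k+1)^2}\sum_{i=0}^{k-1}\bigl(s_i-(i+1)(2i+1-k)f_S^{i+1}(t)\bigr)f_S^{k-i}(t).$$ Derivatives are formal. *)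

(* Defs.v *)
From mathcomp Require Import all_boot all_order all_algebra.
From mathcomp Require Import reals complex.

Set Implicit Arguments.
Unset Strict Implicit.
Unset Printing Implicit Defensive.

Import GRing.Theory.
Local Open Scope ring_scope.

(* A formal power series is its sequence of coefficients. The operations carry
   their own notations, since the ring operations that function types may
   inherit act pointwise and are not those of formal power series. *)
Definition fps (K : Type) : Type := nat -> K.

Declare Scope fps_scope.
Delimit Scope fps_scope with fps.
Bind Scope fps_scope with fps.

Section FormalPowerSeries.
Variable K : pzRingType.
Implicit Types P Q : fps K.

Definition fps_add P Q : fps K := fun n => P n + Q n.
Definition fps_sub P Q : fps K := fun n => P n - Q n.
Definition fps_mul P Q : fps K := fun n => \sum_(i < n.+1) P i * Q (n - i)%N.
Definition fps_var : fps K := fun n => (n == 1%N)%:R.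
Definition fps_deriv P : fps K := fun n => n.+1%:R * P n.+1.

End FormalPowerSeries.

Notation "P + Q" := (fps_add P Q) : fps_scope.
Notation "P - Q" := (fps_sub P Q) : fps_scope.
Notation "P * Q" := (fps_mul P Q) : fps_scope.
Notation "''t'" := (fps_var _) : fps_scope.
Notation "P ^` ()" := (fps_deriv P) : fps_scope.

Section RecursivePolynomials.
Variables (K : fieldType) (S : fps K).

(* The polynomial f^(k+1) for k >= 1, where the entry of index j of fs is
   f^j for 1 <= j <= k. *)
Definition fpoly_step (k : nat) (fs : seq {poly K}) : {poly K} :=
  (S k / k.+1%:R ^+ 2)%:P
  + (k.+1%:R ^- 2 *: 'X)
    * \sum_(i < k)
        ((S i)%:P - (i.+1%:R * ((2 * i + 1)%:R - k%:R)) *: fs`_i.+1)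
        * fs`_(k - i).

(* The sequence [:: 0; f^1; ...; f^(n+1)], whose entry of index 0 is a dummy. *)
Fixpoint fpoly_seq (n : nat) : seq {poly K} :=
  if n is m.+1 then rcons (fpoly_seq m) (fpoly_step m.+1 (fpoly_seq m))
  else [:: 0; (S 0)%:P].

Definition fpoly (i : nat) : {poly K} := (fpoly_seq i)`_i.

Lemma size_fpoly_seq n : size (fpoly_seq n) = n.+2.
Proof. by elim: n => //= n IHn; rewrite size_rcons IHn. Qed.

Lemma nth_fpoly_seq n i : (i <= n.+1)%N -> (fpoly_seq n)`_i = fpoly i.
Proof.
rewrite /fpoly.
have incr m j d : (j <= m.+1)%N -> (fpoly_seq (d + m))`_j = (fpoly_seq m)`_j.
  move=> le_jm; elim: d => //= d IHd.
  by rewrite nth_rcons size_fpoly_seq ltnS (leq_trans le_jm) ?ltnS ?leq_addl.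
move=> le_in; case: (leqP i n) => [le_in'|lt_ni].
  by rewrite -(subnK le_in') incr.
have -> : i = n.+1 by apply/eqP; rewrite eqn_leq le_in.
by rewrite -(add1n n) incr.
Qed.

Lemma fpoly1 : fpoly 1 = (S 0)%:P.
Proof. by rewrite -(@nth_fpoly_seq 0). Qed.

Lemma fpolyS k : (1 <= k)%N ->
  fpoly k.+1 =
    (S k / k.+1%:R ^+ 2)%:P
    + (k.+1%:R ^- 2 *: 'X)
      * \sum_(i < k)
          ((S i)%:P - (i.+1%:R * ((2 * i + 1)%:R - k%:R)) *: fpoly i.+1)
          * fpoly (k - i).
Proof.
case: k => // k _; rewrite -(@nth_fpoly_seq k.+1) //= nth_rcons size_fpoly_seq.
rewrite ltnn eqxx /fpoly_step; congr (_ + _ * _); apply: eq_bigr => i _.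
by rewrite !nth_fpoly_seq // ?(leq_trans (leq_subr _ _)) // ltnW.
Qed.

End RecursivePolynomials.

(* Main.v *)
(** Since [tQ'' + Q'] has coefficients [(n+1)^2 q_(n+1)], the coefficient of
    [t^n] in the equation is
      [(n+1)^2 q_(n+1) q_0 = s_n q_0
        + sum_(i<n) (s_i - (i+1)(2i+1-n) q_(i+1)) q_(n-i)],
    because [(i+1)^2 - (i+1)(n-i) = (i+1)(2i+1-n)]. With [q_0 = 1/a] this
    determines [q_(n+1)] from the earlier coefficients, by the recursion of
    the [f_S^i] evaluated at [a]. *)
Require Import Defs.
From mathcomp Require Import all_boot all_order all_algebra.
From mathcomp Require Import boolp reals complex ring.

Set Implicit Arguments.
Unset Strict Implicit.
Unset Printing Implicit Defensive.

Local Open Scope ring_scope.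
Local Open Scope complex_scope.

Import GRing.Theory Num.Theory.

Section Coefficients.
Variable K : pzRingType.
Implicit Types P Q : fps K.

Lemma fps_mul_var0 P : ('t * P)%fps 0%N = 0.
Proof. by rewrite /fps_mul big_ord1 mul0r. Qed.

Lemma fps_mul_varS P n : ('t * P)%fps n.+1 = P n.
Proof.
rewrite /fps_mul !big_ord_recl /= mul0r add0r mul1r subSS subn0.
by rewrite big1 ?addr0 // => i _; rewrite /fps_var mul0r.
Qed.

Lemma fps_var_deriv2D_deriv Q n :
  ('t * Q^`()^`() + Q^`())%fps n = n.+1%:R ^+ 2 * Q n.+1.
Proof.
case: n => [|n]; rewrite /fps_add ?fps_mul_var0 ?fps_mul_varS /fps_deriv.
  by rewrite add0r expr1n.
(* Here the two weights combine as (n+1)(n+2) + (n+2) = (n+2)^2. *)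
by rewrite mulrA -mulrDl -{2}[n.+2%:R]mul1r -mulrDl natr1 expr2.
Qed.

Lemma fps_var_deriv_sqr Q n :
  ('t * (Q^`() * Q^`()))%fps n
  = \sum_(i < n) i.+1%:R * Q i.+1 * ((n - i)%:R * Q (n - i)%N).
Proof.
case: n => [|n]; first by rewrite fps_mul_var0 big_ord0.
rewrite fps_mul_varS; apply: eq_bigr => i _.
by rewrite /fps_deriv -subSn // -ltnS.
Qed.

End Coefficients.

Section Recursion.
Variable K : numFieldType.
Implicit Types (S Q : fps K) (a : K).

(** The last term of each product carries [Q 0] and is split off; the remaining sum involves only
    the coefficients of [Q] of index 1 to [n]. *)
Lemma coef_equation S Q n :
  (('t * Q^`()^`() + Q^`()) * Q - 't * (Q^`() * Q^`()))%fps n = (S * Q)%fps n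
  <-> n.+1%:R ^+ 2 * Q n.+1 * Q 0%N = S n * Q 0%N
      + \sum_(i < n)
          (S i - i.+1%:R * ((2 * i + 1)%:R - n%:R) * Q i.+1) * Q (n - i)%N.
Proof.
rewrite {1}/fps_sub fps_var_deriv_sqr /fps_mul !big_ord_recr /= subnn.
rewrite fps_var_deriv2D_deriv.
under eq_bigr do rewrite fps_var_deriv2D_deriv.
set A := \sum_(i < n) _; set B := \sum_(i < n) _; set C := \sum_(i < n) _.
set D := \sum_(i < n) (_ - _) * _.
have -> : D = C - (A - B).
  rewrite /A /B /C /D -!sumrB; apply: eq_bigr => i _.
  by rewrite natrB ?(ltnW (ltn_ord i)) //; ring.
set x := _ * Q 0%N; set y := S n * _.
split=> [e|->]; last by ring.
(* The hypothesis reads [A + x - B = C + y], so adding [A - B] to both sides of the goal exposes its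
   left-hand side. *)
by apply: (addrI (A - B)); rewrite addrAC e; ring.
Qed.

(** At [k = 0] the sum is empty and the right-hand side is s_0, so one formula covers both clauses
    of the recursion. *)
Lemma horner_fpolyS S a k :
  (fpoly S k.+1).[a] = (S k + a * \sum_(i < k)
    (S i - i.+1%:R * ((2 * i + 1)%:R - k%:R) * (fpoly S i.+1).[a])
    * (fpoly S (k - i)).[a]) / k.+1%:R ^+ 2.
Proof.
case: k => [|k].
  by rewrite fpoly1 hornerC big_ord0 mulr0 addr0 expr1n divr1.
rewrite fpolyS // hornerD hornerC hornerM hornerZ hornerX horner_sum mulrDl.
rewrite [_^-1 * a]mulrC mulrAC; congr (_ + _ * _ / _); apply: eq_bigr => i _.
by rewrite hornerM hornerD hornerN hornerZ hornerC.
Qed.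

Lemma fps_equation_iff_fpoly S Q a : a != 0 -> Q 0%N = 1 / a ->
  (('t * Q^`()^`() + Q^`()) * Q - 't * (Q^`() * Q^`()) = S * Q)%fps
  <-> (forall i, (1 <= i)%N -> Q i = (fpoly S i).[a]).
Proof.
move=> a0 Q0.
(* Agreement up to index [n] makes the two conditions equivalent one step further. The converse
   direction supplies this agreement outright, the direct one by strong induction. *)
have recP n : (forall i, (1 <= i <= n)%N -> Q i = (fpoly S i).[a]) ->
    (('t * Q^`()^`() + Q^`()) * Q - 't * (Q^`() * Q^`()))%fps n
      = (S * Q)%fps n <-> Q n.+1 = (fpoly S n.+1).[a].
  move=> IH; rewrite coef_equation horner_fpolyS Q0.
  under eq_bigr => i _.
    rewrite !IH ?leq_subr ?subn_gt0 ?ltn_ord //.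
    over.
  set D := \sum_(i < n) _.
  (* Characteristic zero enters here: (n+1)^2 must be invertible to solve for [Q n.+1]. *)
  have n0 : n.+1%:R != 0 :> K by rewrite pnatr_eq0.
  split=> [e|->]; last by field; rewrite a0 nat1r.
  (* Multiplying by [a] cancels the factor q_0 = 1/a. *)
  have {}e : n.+1%:R ^+ 2 * Q n.+1 = S n + a * D.
    have -> : S n + a * D = (S n * (1 / a) + D) * a by field.
    by rewrite -e; field.
  by rewrite -e mulrC mulKf // expf_neq0.
split=> [e i | e]; last first.
  by apply/funext => n; apply/recP => [i /andP[i1 _]|]; exact: e.
elim/ltn_ind: i => -[//|n] IH _; apply/recP; last by rewrite e.
by move=> i /andP[i1 le_in]; exact: IH.
Qed.

End Recursion.

Theorem proposition2p1 (R : realType) (S : fps R[i]) (a : R[i]) (ha : a != 0)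
    (Q : fps R[i]) (hQ0 : Q 0%N = 1 / a) :
  (('t * Q^`()^`() + Q^`()) * Q - 't * (Q^`() * Q^`()) = S * Q)%fps
  <-> (forall i : nat, (1 <= i)%N -> Q i = (fpoly S i).[a]).
Proof. exact: fps_equation_iff_fpoly. Qed.
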